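(* For every integer $n\ge 3$, $\tilde{r}(C_3,P_n)\le 3n-4$.
   Context: In the online size Ramsey game $\mathcal R(H_1,H_2)$, played on the edge set of the infinite complete graph $K_{\mathbb N}$, in each round Builder selects a previously unselected edge and Painter colours it red or blue; the game ends as soon as there is a red copy of $H_1$ or a blue copy of $H_2$. Builder tries to end the game as soon as possible, Painter tries to delay it, and $\tilde r(H_1,H_2)$ is the number of rounds under optimal play of both players. $C_3$ is the triangle and $P_n$ is the path on $n$ vertices. *)

(* Defs.v *)
From Stdlib Require Import List Arith.
Import ListNotations.

(* Colours: true = red, false = blue. *)
(* A history is the list of coloured edges so far (most recent first);
   an entry (x, y, c) means the edge {x, y} of K_N got colour c. *)
Definition history := list (nat * nat * bool).

Definition colored (h : history) (x y : nat) (c : bool) : Prop :=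
  In (x, y, c) h \/ In (y, x, c) h.

Definition selected (h : history) (x y : nat) : Prop :=
  exists c, colored h x y c.

Definition red_triangle (h : history) : Prop :=
  exists a b c, a <> b /\ b <> c /\ a <> c /\
    colored h a b true /\ colored h b c true /\ colored h a c true.

Definition blue_path (n : nat) (h : history) : Prop :=
  exists f : nat -> nat,
    (forall i j, i < n -> j < n -> f i = f j -> i = j) /\
    (forall i, S i < n -> colored h (f i) (f (S i)) false).

Definition game_over (n : nat) (h : history) : Prop :=
  red_triangle h \/ blue_path n h.

(* builder_wins n k h : from position h, Builder can force the game
   R(C_3, P_n) to end within at most k further rounds, whatever Painter does. *)
Fixpoint builder_wins (n k : nat) (h : history) : Prop :=
  match k with
  | 0 => game_over n h
  | S k' => game_over n h \/
      exists x y, x <> y /\ ~ selected h x y /\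
        forall c : bool, builder_wins n k' ((x, y, c) :: h)
  end.

Definition online_ramsey_C3_Pn_le (n k : nat) : Prop := builder_wins n k [].

(* Main.v *)
Require Import Defs.
From Stdlib Require Import List Arith Lia Permutation.
Import ListNotations.

(** Builder keeps two disjoint blue paths whose heads are joined by a red edge,
    and probes a new vertex [y] from the tail of the shorter path.  A blue answer
    lengthens the shorter path.  After a red answer he joins [y] to the head of
    the longer path: blue lengthens that path and restores the red link (with the
    shorter path reversed), while red forces two further blue edges that splice
    both paths and [y] into one path.  Paths of [l] and [m] vertices are won in
    [3 n - l - m - max l m - 1] rounds, and a single path of [p] vertices in
    [3 n - 2 p - 1] rounds.  This is one round too many if the game starts with two
    red edges [0 1], [0 2]; so the forced blue edge [1 2] is then not played but
    recorded as a debt of the path containing it, to be settled only when it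
    completes a path on [n] vertices. *)

Definition red (h : history) (x y : nat) : Prop := colored h x y true.
Definition blue (h : history) (x y : nat) : Prop := colored h x y false.

Lemma colored_sym h x y c : colored h x y c -> colored h y x c.
Proof. unfold colored; tauto. Qed.

Lemma colored_incl h h' x y c : incl h h' -> colored h x y c -> colored h' x y c.
Proof. unfold colored; intros Hi [H | H]; auto. Qed.

Lemma colored_dec h x y c : {colored h x y c} + {~ colored h x y c}.
Proof.
  assert (dec : forall e e' : nat * nat * bool, {e = e'} + {e <> e'})
    by (repeat decide equality).
  unfold colored.
  destruct (in_dec dec (x, y, c) h); [tauto |].
  destruct (in_dec dec (y, x, c) h); tauto.
Qed.

Lemma game_over_builder_wins n k h : game_over n h -> builder_wins n k h.
Proof. destruct k; simpl; auto. Qed.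

Lemma builder_wins_S n k h : builder_wins n k h -> builder_wins n (S k) h.
Proof.
  revert h; induction k as [| k IH]; intros h; [simpl; auto |].
  intros [Hover | (x & y & Hxy & Hnew & Hwin)]; [left; exact Hover |].
  right; exists x, y; repeat split; auto.
Qed.

Lemma red_triangle_intro h x y z :
  x <> y -> y <> z -> x <> z -> red h x y -> red h y z -> red h x z -> red_triangle h.
Proof. intros; exists x, y, z; repeat split; assumption. Qed.

(* The edge may already have been selected: Builder then simply saves a round. *)
Lemma builder_wins_ask n k h x y :
  x <> y ->
  (forall h', incl h h' -> blue h' x y -> builder_wins n k h') ->
  (forall h', incl h h' -> red h' x y -> builder_wins n k h') ->
  builder_wins n (S k) h.
Proof.
  intros Hxy Hblue Hred.
  destruct (colored_dec h x y true) as [Hr | Hr];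
    [apply builder_wins_S, Hred; auto using incl_refl |].
  destruct (colored_dec h x y false) as [Hb | Hb];
    [apply builder_wins_S, Hblue; auto using incl_refl |].
  right; exists x, y; repeat split; trivial.
  - intros [[] Hc]; auto.
  - intros []; [apply Hred | apply Hblue]; try (apply incl_tl, incl_refl);
      left; left; reflexivity.
Qed.

Definition red_common_neighbour (h : history) (x y : nat) : Prop :=
  exists w, w <> x /\ w <> y /\ x <> y /\ red h w x /\ red h w y.

Lemma red_common_neighbour_sym h x y :
  red_common_neighbour h x y -> red_common_neighbour h y x.
Proof. intros (w & ? & ? & ? & ? & ?); exists w; auto. Qed.

Lemma red_common_neighbour_incl h h' x y :
  incl h h' -> red_common_neighbour h x y -> red_common_neighbour h' x y.
Proof.
  intros Hi (w & ? & ? & ? & ? & ?); exists w.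
  repeat split; trivial; eapply colored_incl; eassumption.
Qed.

Lemma builder_wins_forced n k h x y :
  red_common_neighbour h x y ->
  (forall h', incl h h' -> blue h' x y -> builder_wins n k h') ->
  builder_wins n (S k) h.
Proof.
  intros (w & Hx & Hy & Hxy & Hwx & Hwy) Hblue.
  apply builder_wins_ask with x y; trivial.
  intros h' Hi Hr; apply game_over_builder_wins; left.
  apply red_triangle_intro with w x y; trivial; eapply colored_incl; eassumption.
Qed.

(* The debt counts the edges still to be played; all of these are forced to be blue. *)
Inductive edge_with_debt (h : history) (x y : nat) : nat -> Prop :=
| edge_blue : blue h x y -> edge_with_debt h x y 0
| edge_forced : red_common_neighbour h x y -> edge_with_debt h x y 1.

Inductive path_with_debt (h : history) : nat -> list nat -> Prop :=
| path_nil : path_with_debt h 0 []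
| path_single x : path_with_debt h 0 [x]
| path_cons x y l c d :
    edge_with_debt h x y c -> path_with_debt h d (y :: l) ->
    path_with_debt h (c + d) (x :: y :: l).

Lemma edge_sym h x y c : edge_with_debt h x y c -> edge_with_debt h y x c.
Proof.
  intros [Hb | Hf]; constructor;
    [apply colored_sym | apply red_common_neighbour_sym]; trivial.
Qed.

Lemma edge_incl h h' x y c : incl h h' -> edge_with_debt h x y c -> edge_with_debt h' x y c.
Proof.
  intros Hi [Hb | Hf]; constructor;
    [eapply colored_incl | eapply red_common_neighbour_incl]; eassumption.
Qed.

Lemma path_incl h h' d l : incl h h' -> path_with_debt h d l -> path_with_debt h' d l.
Proof. intros Hi; induction 1; constructor; trivial; eapply edge_incl; eassumption. Qed.

Lemma path_pair h x y c : edge_with_debt h x y c -> path_with_debt h c [x; y].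
Proof. intros Hxy; rewrite <- (Nat.add_0_r c); repeat constructor; trivial. Qed.

Lemma path_cons_blue h x y l d :
  blue h x y -> path_with_debt h d (y :: l) -> path_with_debt h d (x :: y :: l).
Proof. intros Hb; apply (path_cons h x y l 0 d); constructor; exact Hb. Qed.

Lemma path_without_debt_inv {h x y l} :
  path_with_debt h 0 (x :: y :: l) -> blue h x y /\ path_with_debt h 0 (y :: l).
Proof.
  inversion 1 as [| | x' y' l' c d Hxy Hl Ecd]; subst.
  destruct Hxy; [| discriminate]; simpl in Ecd; subst; auto.
Qed.

Lemma path_first_edge h l : path_with_debt h 0 l -> path_with_debt h 0 (firstn 2 l).
Proof.
  destruct l as [| x [| y l]]; trivial; intros Hl.
  apply path_pair, edge_blue; exact (proj1 (path_without_debt_inv Hl)).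
Qed.

Lemma path_app h c d e l z x l' :
  path_with_debt h d (l ++ [z]) -> edge_with_debt h z x c -> path_with_debt h e (x :: l') ->
  path_with_debt h (d + (c + e)) (l ++ z :: x :: l').
Proof.
  revert d; induction l as [| s l IH]; simpl; intros d Hl Hzx Hl'.
  - inversion Hl; subst; exact (path_cons h z x l' c e Hzx Hl').
  - destruct l as [| t l]; inversion Hl; subst; rewrite <- Nat.add_assoc;
      constructor; trivial; apply IH; trivial.
Qed.

Lemma path_rev h d l : path_with_debt h d l -> path_with_debt h d (rev l).
Proof.
  induction 1 as [| | x y l c d Hxy Hl IH]; try (constructor; fail).
  simpl in *; rewrite <- app_assoc.
  replace (c + d) with (d + (c + 0)) by lia.
  apply path_app; [exact IH | apply edge_sym, Hxy | constructor].
Qed.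

Lemma path_nth h l i :
  path_with_debt h 0 l -> S i < length l -> blue h (nth i l 0) (nth (S i) l 0).
Proof.
  revert l; induction i as [| i IH]; intros [| x [| y l]] Hl Hi; simpl in Hi; try lia;
    destruct (path_without_debt_inv Hl) as [Hxy Hyl].
  - exact Hxy.
  - apply (IH (y :: l)); [exact Hyl | simpl; lia].
Qed.

Lemma path_game_over n h l :
  NoDup l -> path_with_debt h 0 l -> n <= length l -> game_over n h.
Proof.
  intros Hdup Hl Hn; right; exists (fun i => nth i l 0); split.
  - intros i j Hi Hj; apply NoDup_nth; auto; lia.
  - intros i Hi; apply path_nth; auto; lia.
Qed.

Lemma path_pay_debt h d l :
  path_with_debt h (S d) l ->
  exists x y, red_common_neighbour h x y /\
    forall h', incl h h' -> blue h' x y -> path_with_debt h' d l.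
Proof.
  remember (S d) as d' eqn:Ed; intros Hl; revert d Ed.
  induction Hl as [| | x y l c d' Hxy Hl IH]; intros d Ed; try discriminate.
  destruct Hxy as [Hb | Hf].
  - destruct (IH d Ed) as (s & t & Hst & Hpaid); exists s, t; split; trivial.
    intros h' Hi Hb'; apply path_cons_blue; auto; eapply colored_incl; eassumption.
  - injection Ed as <-; exists x, y; split; trivial.
    intros h' Hi Hb'; apply path_cons_blue; trivial; eapply path_incl; eassumption.
Qed.

Lemma path_builder_wins n k h d l :
  d <= k -> NoDup l -> path_with_debt h d l -> n <= length l -> builder_wins n k h.
Proof.
  revert k h; induction d as [| d IH]; intros k h Hd Hdup Hl Hn.
  - eapply game_over_builder_wins, path_game_over; eassumption.
  - destruct k as [| k]; [lia |].
    destruct (path_pay_debt h d l Hl) as (x & y & Hxy & Hpaid).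
    apply builder_wins_forced with x y; trivial.
    intros h' Hi Hb; apply IH; auto; lia.
Qed.

Lemma exists_fresh (l : list nat) : exists y, ~ In y l.
Proof.
  exists (S (list_max l)); intros Hin.
  pose proof (proj1 (list_max_le l (list_max l)) (le_n _)) as Hmax.
  rewrite Forall_forall in Hmax; specialize (Hmax _ Hin); lia.
Qed.

Record linked_paths (h : history) (d e v : nat) (T : list nat) (x : nat) (U : list nat)
  : Prop := {
  linked_NoDup : NoDup ((v :: T) ++ x :: U);
  linked_path_l : path_with_debt h d (v :: T);
  linked_path_r : path_with_debt h e (x :: U);
  linked_red : red h v x
}.

Lemma linked_paths_sym h d e v T x U :
  linked_paths h d e v T x U -> linked_paths h e d x U v T.
Proof.
  intros [Hdup HT HU Hvx]; split; trivial; [| apply colored_sym, Hvx].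
  apply Permutation_NoDup with (2 := Hdup), Permutation_app_comm.
Qed.

Lemma linked_paths_incl {h h' d e v T x U} :
  incl h h' -> linked_paths h d e v T x U -> linked_paths h' d e v T x U.
Proof.
  intros Hi [Hdup HT HU Hvx]; split; trivial;
    [eapply path_incl .. | eapply colored_incl]; eassumption.
Qed.

Lemma linked_paths_heads_neq {h d e v T x U} : linked_paths h d e v T x U -> v <> x.
Proof.
  intros [Hdup _ _ _] ->; inversion Hdup as [| x' l Hx]; apply Hx, in_elt.
Qed.

Lemma linked_paths_head_last_neq {h d e v T x U l z} :
  linked_paths h d e v T x U -> x :: U = l ++ [z] -> z <> v.
Proof.
  intros [Hdup _ _ _] E ->; rewrite E in Hdup; inversion Hdup as [| x' l' Hv].
  apply Hv, in_or_app; right; apply in_elt.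
Qed.

Lemma linked_paths_win_l {h d e v T x U y n k} :
  linked_paths h d e v T x U -> ~ In y ((v :: T) ++ x :: U) -> blue h y v ->
  n <= S (length (v :: T)) -> d <= k -> builder_wins n k h.
Proof.
  intros [Hdup HT _ _] Hy Hb Hn Hd.
  apply path_builder_wins with d (y :: v :: T); trivial.
  - exact (NoDup_app_remove_r (y :: v :: T) _ (NoDup_cons y Hy Hdup)).
  - apply path_cons_blue; trivial.
Qed.

Lemma linked_paths_extend_last {h d e v T x U l z y} :
  linked_paths h d e v T x U -> ~ In y ((v :: T) ++ x :: U) -> x :: U = l ++ [z] ->
  blue h z y -> linked_paths h d e v T x (U ++ [y]).
Proof.
  intros [Hdup HT HU Hvx] Hy Ez Hb; split; trivial.
  - apply (NoDup_cons y Hy), (Permutation_NoDup (Permutation_cons_append _ y)) in Hdup.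
    rewrite <- app_assoc in Hdup; exact Hdup.
  - rewrite app_comm_cons, Ez, <- app_assoc in *; replace e with (e + (0 + 0)) by lia.
    apply path_app; [exact HU | apply edge_blue, Hb | constructor].
Qed.

Lemma linked_paths_extend_reverse {h d e v T x U l z y} :
  linked_paths h d e v T x U -> ~ In y ((v :: T) ++ x :: U) -> x :: U = l ++ [z] ->
  red h z y -> blue h y v -> linked_paths h d e y (v :: T) z (rev l).
Proof.
  intros [Hdup HT HU _] Hy Ez Hr Hb.
  split; try rewrite <- rev_unit, <- Ez; [| | | apply colored_sym, Hr].
  - apply Permutation_NoDup with (2 := NoDup_cons y Hy Hdup), perm_skip.
    apply (Permutation_app_head (v :: T)), Permutation_rev.
  - apply path_cons_blue; trivial.
  - apply path_rev, HU.
Qed.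

Lemma linked_paths_splice {h d e v T x U l z} :
  linked_paths h d e v T x U -> x :: U = l ++ [z] -> blue h z v ->
  NoDup ((x :: U) ++ v :: T) /\ path_with_debt h (e + d) ((x :: U) ++ v :: T).
Proof.
  intros [Hdup HT HU _] Ez Hb; split.
  - apply Permutation_NoDup with (2 := Hdup), Permutation_app_comm.
  - rewrite Ez, <- app_assoc in *.
    apply (path_app h 0); trivial; apply edge_blue, Hb.
Qed.

Lemma builder_wins_probe n k h v x y z :
  y <> v -> y <> z -> z <> v -> red h v x ->
  (forall h', incl h h' -> blue h' z y -> builder_wins n (S (S k)) h') ->
  (forall h', incl h h' -> red h' z y -> blue h' y v -> builder_wins n (S k) h') ->
  (forall h', incl h h' -> z <> x -> red h' y v -> blue h' z v -> builder_wins n k h') ->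
  builder_wins n (S (S (S k))) h.
Proof.
  intros Hyv Hyz Hzv Hvx Hextend Hreverse Hsplice.
  apply builder_wins_ask with z y; [auto | exact Hextend |]; intros h1 Hi1 Hzy.
  apply builder_wins_ask with y v; trivial; intros h2 Hi2 Hyv2.
  - apply Hreverse; trivial; [eapply incl_tran | eapply colored_incl]; eassumption.
  - assert (Hi : incl h h2) by (eapply incl_tran; eassumption).
    assert (Hzy2 : red h2 z y) by (apply (colored_incl h1); trivial).
    destruct (Nat.eq_dec z x) as [-> | Hzx].
    + apply game_over_builder_wins; left.
      apply red_triangle_intro with x y v; auto.
      apply (colored_incl h), colored_sym; trivial.
    + apply builder_wins_forced with z v.
      * exists y; repeat split; trivial; apply colored_sym; exact Hzy2.
      * intros h3 Hi3 Hb; apply Hsplice; trivial;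
          [eapply incl_tran | eapply colored_incl]; eassumption.
Qed.

Lemma linked_paths_one_short_win n k h d e v T x U :
  linked_paths h d e v T x U -> n <= S (length (v :: T)) -> n <= S (length (x :: U)) ->
  d <= k -> S e <= k -> builder_wins n (S k) h.
Proof.
  intros Hlink HT HU Hd He.
  destruct (exists_fresh ((v :: T) ++ x :: U)) as [y Hy].
  assert (Hyv : y <> v) by (intros ->; apply Hy; left; reflexivity).
  assert (Hyx : y <> x) by (intros ->; apply Hy, in_elt).
  apply builder_wins_ask with y v; trivial; intros h1 Hi1 Hc;
    apply (linked_paths_incl Hi1) in Hlink.
  - apply (linked_paths_win_l Hlink Hy); trivial.
  - destruct k as [| k]; [lia |].
    apply builder_wins_forced with y x.
    + exists v; pose proof (linked_paths_heads_neq Hlink).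
      repeat split; auto; [apply colored_sym, Hc | apply Hlink].
    + intros h2 Hi2 Hb; apply (linked_paths_incl Hi2), linked_paths_sym in Hlink.
      apply (linked_paths_win_l (y := y) Hlink); trivial; [| lia].
      rewrite in_app_iff in *; tauto.
Qed.

Lemma linked_paths_splice_game_over {n h d e v T x U l z} :
  d + e <= 1 -> linked_paths h d e v T x U -> x :: U = l ++ [z] -> blue h z v ->
  path_with_debt h 0 (firstn 2 (v :: T)) -> 2 <= length (v :: T) ->
  n <= S (length (v :: T)) -> n <= 2 + length (x :: U) ->
  game_over n h.
Proof.
  intros Hde Hlink Ez Hb Hfirm HT2 HT HU.
  destruct (linked_paths_splice Hlink Ez Hb) as [Hdup _].
  destruct Hlink as [_ HpathT HpathU _]; rewrite Ez in *.
  destruct d as [| d].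
  - apply path_game_over with (z :: v :: T); trivial.
    + apply (NoDup_app_remove_l l).
      rewrite <- app_assoc in Hdup; exact Hdup.
    + apply path_cons_blue; trivial.
  - assert (e = 0) as -> by lia.
    apply path_game_over with ((l ++ [z]) ++ firstn 2 (v :: T)).
    + apply NoDup_app_remove_r with (skipn 2 (v :: T)).
      rewrite <- app_assoc, firstn_skipn; exact Hdup.
    + rewrite <- app_assoc; apply (path_app h 0 0 0); trivial; apply edge_blue, Hb.
    + rewrite length_app, length_firstn; lia.
Qed.

(* Builder cannot afford to settle a debt on the first edge of a path on [n - 1] vertices
   when the other path has only [n - 2] vertices. *)
Definition short_or_firm (h : history) (l l' : list nat) : Prop :=
  length l <= max 2 (length l') \/ path_with_debt h 0 (firstn 2 l).

Lemma short_or_firm_incl h h' l l' :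
  incl h h' -> short_or_firm h l l' -> short_or_firm h' l l'.
Proof. intros Hi [Hle | Hfirm]; [left | right; eapply path_incl]; eassumption. Qed.

Inductive favourable (n k : nat) (h : history) : Prop :=
| favourable_single d v P :
    d <= 1 -> d <= k -> NoDup (v :: P) -> path_with_debt h d (v :: P) ->
    path_with_debt h 0 (firstn 2 (v :: P)) ->
    3 * n <= k + 2 * length (v :: P) + 1 ->
    favourable n k h
| favourable_linked d e v T x U :
    d + e <= 1 -> linked_paths h d e v T x U ->
    short_or_firm h (v :: T) (x :: U) -> short_or_firm h (x :: U) (v :: T) ->
    length (v :: T) < n -> length (x :: U) < n ->
    3 * n <= k + length (v :: T) + length (x :: U)
             + max (length (v :: T)) (length (x :: U)) + 1 ->
    favourable n k h.

Lemma favourable_extend_last n k h d e v T x U l z y :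
  d + e <= 1 -> linked_paths h d e v T x U -> ~ In y ((v :: T) ++ x :: U) ->
  x :: U = l ++ [z] -> blue h z y -> short_or_firm h (v :: T) (x :: U) ->
  length (v :: T) < n -> length (x :: U) + e <= length (v :: T) ->
  length (x :: U) + 2 <= n ->
  3 * n <= k + 2 * length (v :: T) + length (x :: U) + 2 ->
  favourable n k h.
Proof.
  intros Hde Hlink Hy Ez Hb Hfirm HT HUT HU Hn.
  pose proof (linked_paths_extend_last Hlink Hy Ez Hb) as Hext.
  apply favourable_linked with d e v T x (U ++ [y]); trivial;
    try (simpl length in *; rewrite length_app; simpl length; lia).
  - destruct Hfirm as [Hle | Hedge]; [left | right; exact Hedge].
    simpl length in *; rewrite length_app; lia.
  - destruct e as [| e].
    + right; apply path_first_edge, Hext.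
    + left; simpl length in *; rewrite length_app; simpl length; lia.
Qed.

Lemma favourable_extend_reverse n k h d e v T x U l z y :
  d + e <= 1 -> linked_paths h d e v T x U -> ~ In y ((v :: T) ++ x :: U) ->
  x :: U = l ++ [z] -> red h z y -> blue h y v ->
  length (x :: U) <= length (v :: T) -> length (v :: T) + 1 < n ->
  3 * n <= k + 2 * length (v :: T) + length (x :: U) + 3 ->
  favourable n k h.
Proof.
  intros Hde Hlink Hy Ez Hr Hb HUT HT Hn.
  assert (Elen : length (z :: rev l) = length (x :: U))
    by (rewrite <- rev_unit, <- Ez; apply length_rev).
  apply favourable_linked with d e y (v :: T) z (rev l); rewrite ?Elen;
    trivial; try (simpl length in *; lia).
  - apply (linked_paths_extend_reverse Hlink Hy Ez); trivial.
  - right; apply path_pair, edge_blue, Hb.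
  - left; rewrite Elen; simpl length in *; lia.
Qed.

Lemma favourable_blue_edge n k h x y :
  1 <= k -> 3 * n <= k + 5 -> x <> y -> blue h x y -> favourable n k h.
Proof.
  intros Hk Hn Hxy Hb.
  assert (Hpath : path_with_debt h 0 [x; y]) by (apply path_pair, edge_blue, Hb).
  apply favourable_single with 0 x [y]; simpl length; trivial; try lia.
  repeat constructor; simpl; intuition.
Qed.

Lemma favourable_linked_edge n k h c v u x :
  3 <= n -> 3 * n <= k + 6 -> NoDup [v; u; x] -> edge_with_debt h v u c -> red h v x ->
  favourable n k h.
Proof.
  intros Hn Hk Hdup Hvu Hvx.
  apply favourable_linked with c 0 v [u] x []; simpl length; try lia;
    try (left; simpl; lia).
  - destruct Hvu; lia.
  - split; trivial; [apply path_pair, Hvu | constructor].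
Qed.

Section Induction.

Variables n k : nat.
Hypothesis IH :
  forall k', k' < k -> forall h, favourable n k' h -> builder_wins n k' h.

Lemma single_path_wins h d v P :
  d <= 1 -> d <= k -> NoDup (v :: P) -> path_with_debt h d (v :: P) ->
  path_with_debt h 0 (firstn 2 (v :: P)) ->
  3 * n <= k + 2 * length (v :: P) + 1 ->
  builder_wins n k h.
Proof.
  intros Hd1 Hdk Hdup HP Hfirm Hn.
  destruct (le_lt_dec n (length (v :: P))) as [Hlen | Hlen];
    [apply path_builder_wins with d (v :: P); trivial |].
  destruct (exists_fresh (v :: P)) as [x Hx].
  assert (Hvx : v <> x) by (intros ->; apply Hx; left; reflexivity).
  destruct k as [| k']; simpl length in *; [lia |].
  apply builder_wins_ask with v x; trivial; intros h' Hi Hc;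
    apply (path_incl _ _ _ _ Hi) in HP, Hfirm; apply IH; try lia.
  - apply favourable_single with d x (v :: P); simpl length; trivial; try lia.
    + constructor; trivial.
    + apply path_cons_blue; trivial; apply colored_sym; trivial.
    + apply path_pair, edge_blue, colored_sym; trivial.
  - apply favourable_linked with d 0 v P x []; simpl length; trivial; try lia.
    + split; trivial; [| constructor].
      apply (Permutation_NoDup (Permutation_cons_append (v :: P) x)).
      constructor; trivial.
    + right; trivial.
    + left; simpl; lia.
Qed.

Lemma linked_paths_splice_wins j h d e v T x U l z y :
  j < k -> d + e <= 1 -> linked_paths h d e v T x U -> ~ In y ((v :: T) ++ x :: U) ->
  x :: U = l ++ [z] -> z <> x -> red h y v -> blue h z v ->
  short_or_firm h (v :: T) (x :: U) -> length (v :: T) < n ->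
  length (x :: U) + 2 <= n ->
  3 * n <= j + 2 * length (v :: T) + length (x :: U) + 4 ->
  builder_wins n j h.
Proof.
  intros Hj Hde Hlink Hy Ez Hzx Hr Hb Hfirm HT HU Hn.
  destruct (linked_paths_splice Hlink Ez Hb) as [Hdup Hpath].
  assert (HU2 : 2 <= length (x :: U)).
  { destruct U; [destruct l as [| s [| t l]]; injection Ez; congruence | simpl; lia]. }
  destruct (le_lt_dec n (S (length (v :: T)))) as [HTlast | HTmore].
  - destruct j as [| j].
    + destruct Hfirm as [Hshort | Hfirm]; [lia |].
      apply (linked_paths_splice_game_over Hde Hlink Ez); trivial; lia.
    + apply path_builder_wins with (e + d) ((x :: U) ++ v :: T); trivial; [lia |].
      rewrite length_app; lia.
  - destruct j as [| j]; [lia |].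
    apply builder_wins_forced with y x.
    + exists v; repeat split; [| | | apply colored_sym, Hr | apply Hlink].
      * intros ->; apply Hy; left; reflexivity.
      * exact (linked_paths_heads_neq Hlink).
      * intros ->; apply Hy, in_elt.
    + intros h' Hi Hb'; apply IH; [lia |].
      apply favourable_single with (e + d) y ((x :: U) ++ v :: T); trivial; try lia.
      * constructor; trivial; rewrite in_app_iff in *; tauto.
      * apply path_cons_blue; trivial; apply (path_incl _ _ _ _ Hi), Hpath.
      * apply path_pair, edge_blue; exact Hb'.
      * change (length (y :: ?l)) with (S (length l)); rewrite length_app; lia.
Qed.

Lemma linked_paths_longer_wins h d e v T x U :
  d + e <= 1 -> linked_paths h d e v T x U -> short_or_firm h (v :: T) (x :: U) ->
  length (v :: T) < n -> length (x :: U) + e <= length (v :: T) ->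
  3 * n <= k + 2 * length (v :: T) + length (x :: U) + 1 ->
  builder_wins n k h.
Proof.
  intros Hde Hlink Hfirm HT HUT Hn.
  destruct (le_lt_dec n (S (length (x :: U)))) as [HUlast | HUmore].
  { destruct k as [| j]; [lia |].
    apply linked_paths_one_short_win with d e v T x U; trivial; lia. }
  destruct (exists_fresh ((v :: T) ++ x :: U)) as [y Hy].
  destruct (@exists_last _ (x :: U)) as (l & z & Ez); [discriminate |].
  assert (exists j, k = 3 + j) as [j Ej] by (exists (k - 3); lia).
  rewrite Ej; apply builder_wins_probe with v x y z.
  - intros ->; apply Hy; left; reflexivity.
  - intros ->; apply Hy, in_or_app; right; rewrite Ez; apply in_elt.
  - exact (linked_paths_head_last_neq Hlink Ez).
  - apply Hlink.
  - intros h' Hi Hb; apply IH; [lia |].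
    apply favourable_extend_last with d e v T x U l z y; trivial; try lia.
    + exact (linked_paths_incl Hi Hlink).
    + exact (short_or_firm_incl _ _ _ _ Hi Hfirm).
  - intros h' Hi Hr Hb; apply (linked_paths_incl Hi) in Hlink.
    destruct (le_lt_dec n (S (length (v :: T)))) as [HTlast | HTmore].
    + apply (linked_paths_win_l Hlink Hy); trivial; lia.
    + apply IH; [lia |].
      apply favourable_extend_reverse with d e v T x U l z y; trivial; lia.
  - intros h' Hi Hzx Hr Hb.
    apply linked_paths_splice_wins with d e v T x U l z y; trivial; try lia.
    + exact (linked_paths_incl Hi Hlink).
    + exact (short_or_firm_incl _ _ _ _ Hi Hfirm).
Qed.

Lemma linked_paths_win h d e v T x U :
  d + e <= 1 -> linked_paths h d e v T x U ->
  short_or_firm h (v :: T) (x :: U) -> short_or_firm h (x :: U) (v :: T) ->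
  length (v :: T) < n -> length (x :: U) < n ->
  3 * n <= k + length (v :: T) + length (x :: U)
           + max (length (v :: T)) (length (x :: U)) + 1 ->
  builder_wins n k h.
Proof.
  intros Hde Hlink HfirmT HfirmU HT HU Hn.
  destruct (le_lt_dec (length (x :: U) + e) (length (v :: T))) as [Hle | Hlt].
  - apply linked_paths_longer_wins with d e v T x U; trivial; lia.
  - apply linked_paths_sym in Hlink.
    apply linked_paths_longer_wins with e d x U v T; trivial; lia.
Qed.

End Induction.

Lemma favourable_builder_wins n k h : favourable n k h -> builder_wins n k h.
Proof.
  revert h; induction k as [k IH] using lt_wf_ind; intros h [d v P | d e v T x U].
  - apply single_path_wins with d v P; trivial.
  - apply linked_paths_win with d e v T x U; trivial.
Qed.

Theorem theorem2 : forall n : nat, 3 <= n -> online_ramsey_C3_Pn_le n (3 * n - 4).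
Proof.
  intros n Hn; unfold online_ramsey_C3_Pn_le.
  replace (3 * n - 4) with (S (S (3 * n - 6))) by lia.
  apply builder_wins_ask with 0 1; [lia | |]; intros h1 _ H01.
  - apply favourable_builder_wins, favourable_blue_edge with 0 1; trivial; lia.
  - apply builder_wins_ask with 0 2; [lia | |]; intros h2 Hi H02;
      apply (colored_incl _ _ _ _ _ Hi) in H01; apply favourable_builder_wins.
    + apply favourable_linked_edge with 0 0 2 1; trivial; [lia | |].
      * repeat constructor; simpl; lia.
      * apply edge_blue, H02.
    + apply favourable_linked_edge with 1 1 2 0; trivial; [lia | | |].
      * repeat constructor; simpl; lia.
      * apply edge_forced; exists 0; repeat split; trivial; lia.
      * apply colored_sym, H01.
Qed.
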